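(* Let $(W,T)$ be a spherical crystallographic dual Coxeter system of rank $n$ with root system $\Phi$. If $\{\alpha_1,\dots,\alpha_n\}$ is a simple system for $\Phi$, $P=\langle s_{\alpha_1},\dots,s_{\alpha_{n-1}}\rangle$ is a parabolic subgroup and $W=\langle P,s_\beta\rangle$ for some $\beta\in\Phi$, then there is $w\in P$ such that $w(\beta)=\alpha_n$.
   Context: Let $(V,(\cdot\mid\cdot))$ be a Euclidean space of dimension $n$; for $0\neq\alpha\in V$ let $s_\alpha(v)=v-\frac{2(\alpha\mid v)}{(\alpha\mid\alpha)}\alpha$ be the reflection in the hyperplane orthogonal to $\alpha$. A crystallographic root system in $V$ is a finite set $\Phi$ of nonzero vectors spanning $V$ such that $s_\alpha(\Phi)=\Phi$, $\Phi\cap\mathbb{R}\alpha=\{\pm\alpha\}$ and $\frac{2(\alpha\mid\beta)}{(\alpha\mid\alpha)}\in\mathbb{Z}$ for all $\alpha,\beta\in\Phi$. A spherical crystallographic dual Coxeter system of rank $n$ with root system $\Phi$ is the pair $(W,T)$ with $W=\langle s_\alpha\mid\alpha\in\Phi\rangle$ (a finite group) and $T=\{s_\alpha\mid\alpha\in\Phi\}$ its set of reflections, where $\Phi$ is a crystallographic root system in $V$. A simple system for $\Phi$ is a subset $\Delta\subseteq\Phi$ that is a basis of $V$ such that every root is a linear combination of $\Delta$ with integer coefficients that are either all non-negative or all non-positive. A parabolic subgroup of $(W,T)$ is a subgroup generated by a subset of some $S\subseteq T$ for which $(W,S)$ is a Coxeter system; for a simple system $\Delta$ the set $\{s_\alpha\mid\alpha\in\Delta\}$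 is such an $S$.
   Formalization: The claim fails for negative β (e.g. β = −α_n, since P preserves the α_n-coefficient and s_β = s_{−β}); it is proved that some w in P has w(β) = α_n or −α_n, and w(β) = α_n whenever β is positive with respect to the simple system. *)

(* Defs.v *)
From HB Require Import structures.
From mathcomp Require Import all_boot all_order all_algebra.
From mathcomp Require Import classical_sets reals.
Set Implicit Arguments.
Unset Strict Implicit.
Unset Printing Implicit Defensive.
Import Order.TTheory GRing.Theory Num.Theory.
Local Open Scope ring_scope.
Local Open Scope classical_set_scope.

Section Groups.
Context (R : realType) (V : vectType R).
Implicit Types (G H S T I : set 'End(V)).

(* On bijective endomorphisms, [f^-1%VF] is the two-sided inverse. *)
Inductive generated S : set 'End(V) :=
| generated_mem f : S f -> generated S f
| generated_id : generated S \1%VF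
| generated_comp f g :
    generated S f -> generated S g -> generated S (f \o g)%VF
| generated_inv f : generated S f -> generated S (f^-1)%VF.

(* The universal property expresses the presentation
   W = < S | (s t)^m(s,t) = 1 >, where m(s,t) is the order of s t in W; the
   relators are indexed by all multiples m of that order, and there are none
   when the order is infinite. *)
Definition coxeter_system G S :=
  [/\ forall s, S s -> s <> \1%VF /\ (s \o s)%VF = \1%VF,
      G = generated S &
      forall (gT : groupType) (phi : 'End(V) -> gT),
        (forall s t (m : nat), S s -> S t ->
           iter m (comp_lfun (s \o t)%VF) \1%VF = \1%VF ->
           ((phi s * phi t) ^+ m = 1)%g) ->
        exists psi : 'End(V) -> gT,
          (forall s, S s -> psi s = phi s) /\
          (forall f g, G f -> G g -> psi (f \o g)%VF = (psi f * psi g)%g)].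

Definition parabolic G T H :=
  exists S I, [/\ S `<=` T, coxeter_system G S, I `<=` S & H = generated I].

End Groups.

Section RootSystems.
Context (R : realType) (V : vectType R) (B : {dot V for idfun}).
Implicit Types (a b v : V) (Phi : seq V).

Definition refl_fun a v : V := v - (2 * B a v / B a a) *: a.

Definition refl a : 'End(V) := linfun (refl_fun a).

Lemma refl_fun_is_linear a : linear (refl_fun a).
Proof.
move=> c u v; rewrite /refl_fun linearDr linearZr /=.
rewrite mulrDr mulrDl scalerDl opprD scalerBr addrACA scalerA.
by congr (_ - _ *: _ + _); rewrite !mulrA (mulrC 2 c).
Qed.

HB.instance Definition _ a :=
  GRing.isLinear.Build R V V *:%R (refl_fun a) (refl_fun_is_linear a).

Lemma reflE a v : refl a v = v - (2 * B a v / B a a) *: a.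
Proof. by rewrite lfunE. Qed.

(* A list stands for the finite set of its members. *)
Definition root_system Phi :=
  [/\ 0 \notin Phi,
      <<Phi>>%VS = fullv,
      forall a, a \in Phi -> [seq refl a b | b <- Phi] =i Phi,
      forall a, a \in Phi ->
        forall b, b \in Phi /\ (exists c : R, b = c *: a) <-> b = a \/ b = - a
    & forall a b, a \in Phi -> b \in Phi ->
        2 * B a b / B a a \is a Num.int].

Definition reflections Phi : set 'End(V) := [set refl a | a in [set` Phi]].

Definition dual_coxeter_system n Phi (W T : set 'End(V)) :=
  [/\ \dim {:V} = n, root_system Phi, T = reflections Phi & W = generated T].

Definition int_comb n (D : n.-tuple V) (c : 'I_n -> int) : V :=
  \sum_i (c i)%:~R *: tnth D i.

Definition simple_system Phi n (D : n.-tuple V) :=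
  [/\ {subset D <= Phi}, basis_of fullv D &
      forall b, b \in Phi -> exists2 c : 'I_n -> int, b = int_comb D c &
        (forall i, 0 <= c i) \/ (forall i, c i <= 0)].

Definition positive n (D : n.-tuple V) b :=
  exists2 c : 'I_n -> int, b = int_comb D c & forall i, 0 <= c i.

End RootSystems.

(* Main.v *)
From HB Require Import structures.
Require Import Defs.
From mathcomp Require Import all_boot all_order all_algebra.
From mathcomp Require Import classical_sets reals.
From mathcomp Require Import boolp ring lra.
Set Implicit Arguments.
Unset Strict Implicit.
Unset Printing Implicit Defensive.
Local Open Scope ring_scope.
Local Open Scope classical_set_scope.
Import Order.TTheory GRing.Theory Num.Theory.

(** Write $a$ for the last simple root, $g^\vee = 2g/(g|g)$ for the coroot of
    $g$, and let $\omega$ be the vector with $(\omega|\alpha_i) = 0$ for the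
    other simple roots and $(\omega|a) = 1$, so that $c = (\omega|\beta)$ is
    the coefficient of $a$ in $\beta$.  Two opposite comparisons of $|\beta|^2$
    with $c^2|a|^2$ force the result.

    Generation gives $c^2|a|^2 \le |\beta|^2$ ([generating_root_norm]).  The
    generators of $P$ fix $\omega$, and $s_\beta$ moves it by
    $-c\beta^\vee$; since Cartan numbers are integers, the orbit $W\omega$
    stays in $\omega + cM$, where $M$ is the lattice spanned by $\beta^\vee$
    and the $\alpha_i^\vee$ with $\alpha_i \neq a$.  As $s_a \in W$ moves
    $\omega$ by $-a^\vee$, the coroot $a^\vee$ lies in $cM$; pairing with
    $\omega$ yields $|\beta|^2 = k c^2 |a|^2$ with $k$ an integer, necessarily
    positive, and $c \neq 0$.

    Geometry gives the reverse inequality.  Up to replacing $\beta$ by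
    $-\beta$ take $c > 0$.  In the finite orbit $P\beta$ a root $b$ of least
    height satisfies $(\alpha_i|b) \le 0$ for all $\alpha_i \neq a$
    ([parabolic_antidominant]); $b$ still has coefficient $c$ at $a$, so all
    its coefficients are nonnegative, and expanding $b$ twice gives
    $|b|^2 \le c(a|b) \le c^2|a|^2$ ([antidominant_norm]).  Hence both are
    equalities, $|b - ca|^2 = 0$, and reducedness of the root system leaves
    only $b = a$ ([antidominant_eq_simple]). *)

(** * Groups generated by involutions *)

Section Generated.
Context (R : realType) (V : vectType R).
Implicit Types (S T : set 'End(V)) (Q : 'End(V) -> Prop).

Lemma generated_sub S T : S `<=` generated T -> generated S `<=` generated T.
Proof.
move=> ST f; elim=> {f} [f /ST //||f g _ Tf _ Tg|f _ Tf].
- exact: generated_id.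
- exact: generated_comp.
- exact: generated_inv.
Qed.

(** Inverses need no induction step: [f] and its inverse are both products of
    the same involutions, so [Q] is proved for the two of them together. *)
Lemma generated_involutions_ind S Q :
  Q \1%VF -> (forall f g, Q f -> Q g -> Q (f \o g)%VF) ->
  (forall s, S s -> (s \o s)%VF = \1%VF /\ Q s) ->
  forall f, generated S f -> Q f.
Proof.
move=> Q1 QM QS f Sf.
suff [g [_ _ []//]] : exists g, [/\ (g \o f)%VF = \1%VF, (f \o g)%VF = \1%VF
    & Q f /\ Q g].
elim: Sf => {f} [f /QS [ff Qf]||
  f g _ [f' [f'f ff' [Qf Qf']]] _ [g' [g'g gg' [Qg Qg']]]|
  f _ [f' [f'f ff' [Qf Qf']]]].
- by exists f.
- by exists \1%VF; split; rewrite ?comp_lfun1l.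
- exists (g' \o f')%VF; split; last by split; apply: QM.
  + by rewrite comp_lfunA -[X in (X \o g)%VF]comp_lfunA f'f comp_lfun1r.
  + by rewrite comp_lfunA -[X in (X \o f')%VF]comp_lfunA gg' comp_lfun1r.
- have f0 : lker f == 0%VS.
    apply/lker0P => u v /(congr1 f').
    by rewrite -!comp_lfunE f'f !id_lfunE.
  have -> : (f^-1)%VF = f'.
    by rewrite -[LHS]comp_lfun1l -f'f lker0_compfK.
  by exists f.
Qed.

End Generated.

(** * Reflections, simple systems and dual bases *)

Section Euclidean.
Context (R : realType) (V : vectType R) (B : {dot V for idfun}).
Implicit Types (a u v x y : V).

Lemma dotC u v : B u v = B v u.
Proof. by rewrite hermC expr0 mul1r. Qed.

Lemma dot_gt0 u : u != 0 -> 0 < B u u.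
Proof. exact: neq0_dnorm_gt0. Qed.

Lemma dot_eq0 u : B u u = 0 -> u = 0.
Proof. by case: (eqVneq u 0) => // /dot_gt0 /gt_eqF /eqP. Qed.

Lemma reflV a : a != 0 -> refl B a a = - a.
Proof.
move=> /dot_gt0 a0; rewrite reflE mulfK ?gt_eqF//.
by rewrite scaler_nat mulr2n opprD addrA subrr add0r.
Qed.

Lemma refl_invol a : a != 0 -> (refl B a \o refl B a)%VF = \1%VF.
Proof.
move=> a0; apply/lfunP => v; rewrite comp_lfunE id_lfunE [in LHS](reflE _ _ v).
by rewrite linearB linearZ /= reflV// reflE scalerN opprK subrK.
Qed.

Lemma refl_opp a : refl B (- a) = refl B a.
Proof.
apply/lfunP => v; rewrite !reflE linearNl !linearNr linearNl opprK.
by rewrite mulrN mulNr scaleNr scalerN opprK.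
Qed.

Lemma refl_isometry a u v : a != 0 -> B (refl B a u) (refl B a v) = B u v.
Proof.
move=> /dot_gt0 /lt0r_neq0 a0.
rewrite !reflE !linearBl !linearBr !linearZl_LR !linearZr_LR /= (dotC u a).
by field.
Qed.

Section Basis.
Context (n : nat) (D : n.-tuple V).
Hypothesis Dbasis : basis_of fullv D.

(** Nondegeneracy makes pairing with a basis an injection of the space into
    the coordinate space of the same dimension, hence a surjection. *)
Lemma dual_vector (r : 'I_n -> R) : exists x, forall i, B x (tnth D i) = r i.
Proof.
pose h x : 'rV[R]_n := \row_i B x (tnth D i).
have h_lin : linear h.
  by move=> k x y; apply/rowP => i; rewrite !mxE linearDl linearZl_LR.
pose H := GRing.isLinear.Build R V 'rV[R]_n *:%R h h_lin.
pose hl : {linear V -> 'rV[R]_n} := HB.pack h H.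
pose L := linfun hl.
have LE x i : L x 0 i = B x (tnth D i) by rewrite lfunE mxE.
have Ltriv : lker L = 0%VS.
  apply/eqP; rewrite -subv0; apply/subvP => x; rewrite memv_ker => /eqP Lx0.
  rewrite memv0; apply/eqP/dot_eq0.
  rewrite {2}(coord_basis Dbasis (memvf x)) linear_sumr big1 // => i _.
  by rewrite linearZr_LR /= -tnth_nth -LE Lx0 mxE mulr0.
have Lfull : limg L = fullv.
  apply/eqP; rewrite eqEdim subvf limg_dim_eq ?Ltriv ?capv0//.
  by rewrite dimvf dim_matrix (size_basis Dbasis) mul1r leqnn.
have : \row_i r i \in limg L by rewrite Lfull memvf.
move=> /memv_imgP [x _ xr]; exists x => i.
by rewrite -LE -xr mxE.
Qed.

End Basis.
End Euclidean.

(** * Integrality forced by generation *)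

Section Roots.
Context (R : realType) (V : vectType R) (B : {dot V for idfun}) (Phi : seq V).
Hypothesis PhiR : root_system B Phi.
Implicit Types (a b g om y : V) (c d : R).

Lemma root_neq0 a : a \in Phi -> a != 0.
Proof. by case: PhiR => Phi0 _ _ _ _; apply: contraTneq => ->. Qed.

Lemma root_gt0 a : a \in Phi -> 0 < B a a.
Proof. by move=> /root_neq0; apply: dot_gt0. Qed.

Lemma refl_root a b : a \in Phi -> b \in Phi -> refl B a b \in Phi.
Proof. by case: PhiR => _ _ Phis _ _ aP bP; rewrite -(Phis a aP) map_f. Qed.

Lemma oppr_root a : a \in Phi -> - a \in Phi.
Proof. by move=> aP; rewrite -(reflV B (root_neq0 aP)) refl_root. Qed.

Lemma cartan_int a b : a \in Phi -> b \in Phi ->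
  2 * B a b / B a a \is a Num.int.
Proof. by case: PhiR => _ _ _ _; apply. Qed.

Lemma root_line a b k : a \in Phi -> b \in Phi -> b = k *: a ->
  b = a \/ b = - a.
Proof.
case: PhiR => _ _ _ Phired _ aP bP bk.
by apply/(Phired a aP b); split => //; exists k.
Qed.

Definition int_multiple c x := exists2 z : R, z \is a Num.int & x = c * z.

Lemma int_multiple0 c : int_multiple c 0.
Proof. by exists 0; rewrite ?int_num0 ?mulr0. Qed.

Lemma int_multiple_refl c : int_multiple c c.
Proof. by exists 1; rewrite ?int_num1 ?mulr1. Qed.

(** A stand-in for the coset $\omega + cM$ cut out by pairings instead of
    generators: every root pairs integrally with $M$, and $\omega$ pairs
    with $M$ in $\mathbb{Z}d$, where $d$ is to be
    $(\omega|\beta^\vee)$. *)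
Definition weight_coset om c d y :=
  (forall b, b \in Phi -> int_multiple c (B (y - om) b)) /\
  int_multiple (c * d) (B om (y - om)).

Lemma weight_coset_id om c d : weight_coset om c d om.
Proof.
rewrite /weight_coset subrr; split; last by rewrite linear0r; apply: int_multiple0.
by move=> b _; rewrite linear0l; apply: int_multiple0.
Qed.

(** For $y$ in the coset, $(g|y)$ is a multiple of $c$ because $(g|\omega)$
    is; hence $s_g$ moves $y$ by an integral multiple of $cg^\vee$, which the
    coset absorbs. *)
Lemma weight_coset_refl om c d g y : g \in Phi ->
  int_multiple c (B om g) -> int_multiple d (2 * B om g / B g g) ->
  weight_coset om c d y -> weight_coset om c d (refl B g y).
Proof.
move=> gP [z0 z0i E0] [z1 z1i E1] [yPhi [z2 z2i E2]].
have g0 : B g g != 0 by rewrite gt_eqF ?root_gt0.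
have [z3 z3i E3] := yPhi g gP.
have gy : B g y = c * (z0 + z3).
  by rewrite mulrDr -E0 -E3 linearBl /= (dotC B y g) addrC subrK.
rewrite /weight_coset.
have -> : refl B g y - om = (y - om) - (2 * (c * (z0 + z3)) / B g g) *: g.
  by rewrite reflE gy addrAC.
split=> [b bP|].
- have [z4 z4i E4] := yPhi b bP.
  exists (z4 - (z0 + z3) * (2 * B g b / B g g)).
    by rewrite rpredB// rpredM ?rpredD ?cartan_int.
  by rewrite linearBl linearZl_LR /= E4; field.
- exists (z2 - (z0 + z3) * z1); first by rewrite rpredB// rpredM ?rpredD.
  by rewrite linearBr linearZr_LR /= E2 mulrBr -mulrA mulrACA -E1; field.
Qed.

(** The coset is stable under the generators, hence under $W$, so it contains
    $s_a\omega = \omega - a^\vee$.  Its second condition then reads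
    $-2/(a|a) = c \cdot (2c/(b|b)) \cdot z$ for an integer $z$. *)
Lemma generating_root_norm n (D : n.+1.-tuple V) om b (W : set 'End(V)) :
  {subset D <= Phi} -> b \in Phi ->
  (forall i, B om (tnth D i) = (i == ord_max)%:R) ->
  W `<=` generated ([set refl B (tnth D i) | i in [set i : 'I_n.+1 | (i < n)%N]]
                    `|` [set refl B b]) ->
  W (refl B (tnth D ord_max)) ->
  B om b != 0 /\
  B om b ^+ 2 * B (tnth D ord_max) (tnth D ord_max) <= B b b.
Proof.
move=> DP bP omD Wgen Ws.
set a := tnth D ord_max in Ws *; set c := B om b.
have aP : a \in Phi by apply/DP/mem_tnth.
have a0 := root_gt0 aP; have b0 := root_gt0 bP.
pose d := 2 * c / B b b.
have : weight_coset om c d (refl B a om).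
  move: {Ws}(Wgen _ Ws) => Ws.
  apply: (generated_involutions_ind
    (Q := fun f => forall y, weight_coset om c d y -> weight_coset om c d (f y))
    _ _ _ Ws).
  - by move=> y; rewrite id_lfunE.
  - by move=> f g Qf Qg y /Qg/Qf; rewrite comp_lfunE.
  - move=> s [[i /= ilt <-]|->].
    + have iP : tnth D i \in Phi by apply/DP/mem_tnth.
      split; first exact/refl_invol/root_neq0.
      have om0 : B om (tnth D i) = 0.
        by rewrite omD -val_eqE /= ltn_eqF.
      move=> y; apply: weight_coset_refl; rewrite ?om0 ?mulr0 ?mul0r//;
        exact: int_multiple0.
    + split; first exact/refl_invol/root_neq0.
      move=> y; apply: weight_coset_refl; first exact: bP.
        exact: int_multiple_refl.
      exact: int_multiple_refl.
  - exact: weight_coset_id.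
move=> [_ [z zi]].
rewrite reflE (dotC B a) omD eqxx mulr1 addrAC subrr add0r linearNr.
rewrite linearZr_LR /= omD eqxx mulr1 => Ez.
have {}Ez : B b b = c ^+ 2 * B a a * (- z).
  have -> : c ^+ 2 * B a a * (- z) = (- (c * d * z)) * (B a a * B b b) / 2.
    by rewrite /d; field; rewrite gt_eqF.
  by rewrite -Ez; field; rewrite gt_eqF.
have c0 : c != 0.
  by apply/eqP => c0; move: b0; rewrite Ez c0 expr0n /= !mul0r ltxx.
split=> //.
have c2 : 0 < c ^+ 2 * B a a by rewrite mulr_gt0// exprn_even_gt0 /= ?c0.
rewrite Ez; apply: ler_peMr; first exact: ltW.
move: b0; rewrite Ez pmulr_rgt0//.
have /intrP [k ->] : - z \is a Num.int by rewrite rpredN.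
by rewrite ltr0z ler1z gtz0_ge1.
Qed.

(** * Antidominant roots *)

Section Simple.
Context (n : nat) (D : n.+1.-tuple V).
Hypothesis DS : simple_system Phi D.

Let DP i : tnth D i \in Phi.
Proof. by case: DS => DP _ _; apply/DP/mem_tnth. Qed.

Lemma dual_int_comb om (i : 'I_n.+1) (c : 'I_n.+1 -> int) : (forall j, B om (tnth D j) = (j == i)%:R) ->
  B om (int_comb D c) = (c i)%:~R.
Proof.
move=> omD; rewrite /int_comb linear_sumr (bigD1 i)//= big1 ?addr0.
  by rewrite linearZr_LR /= omD eqxx mulr1.
by move=> j ji; rewrite linearZr_LR /= omD (negbTE ji) mulr0.
Qed.

(** One positive coefficient decides the sign of all the coefficients of a
    root. *)
Lemma root_nonneg om i b : (forall j, B om (tnth D j) = (j == i)%:R) ->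
  b \in Phi -> 0 < B om b ->
  exists2 c : 'I_n.+1 -> int, b = int_comb D c & forall j, 0 <= c j.
Proof.
case: DS => _ _ Dcomb omD /Dcomb [c -> [c0|c0]]; rewrite (dual_int_comb _ omD).
  by move=> _; exists c.
by rewrite ltr0z ltNge c0.
Qed.

(** The root $s_i\alpha_j = \alpha_j - k\alpha_i$ has coefficient $1$ at
    $\alpha_j$, so $-k \ge 0$. *)
Lemma simple_obtuse i j : i != j -> B (tnth D i) (tnth D j) <= 0.
Proof.
move=> ij; case: (DS) => _ Dbasis _.
have [om omD] := dual_vector B Dbasis (fun k => (k == j)%:R).
have [om' om'D] := dual_vector B Dbasis (fun k => (k == i)%:R).
have [|c bc c0] := root_nonneg omD (refl_root (DP i) (DP j)).
  rewrite reflE linearBr linearZr_LR /= !omD eqxx (negbTE ij) mulr0 subr0.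
  exact: ltr01.
have := dual_int_comb c om'D; rewrite -bc reflE linearBr linearZr_LR /= !om'D.
rewrite eqxx eq_sym (negbTE ij) mulr1 sub0r => E.
have : 0 <= - (2 * B (tnth D i) (tnth D j) / B (tnth D i) (tnth D i)).
  by rewrite E ler0z.
by rewrite oppr_ge0 pmulr_lle0 ?invr_gt0 ?root_gt0// pmulr_rle0.
Qed.

(** Both inequalities discard nonpositive terms from an expansion of $b$ over
    the simple roots: in the first $(\alpha_i|b) \le 0$ by antidominance, in
    the second $(\alpha_i|a) \le 0$ by obtuseness. *)
Lemma antidominant_norm om b :
  (forall i, B om (tnth D i) = (i == ord_max)%:R) ->
  b \in Phi -> 0 < B om b ->
  (forall i : 'I_n.+1, (i < n)%N -> B (tnth D i) b <= 0) ->
  B b b <= B om b * B (tnth D ord_max) b /\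
  B (tnth D ord_max) b <= B om b * B (tnth D ord_max) (tnth D ord_max).
Proof.
move=> omD bP b0 banti.
have [c bc c0] := root_nonneg omD bP b0.
have omb : B om b = (c ord_max)%:~R by rewrite bc (dual_int_comb _ omD).
have expand v : (forall i, i != ord_max -> B (tnth D i) v <= 0) ->
    B b v <= B om b * B (tnth D ord_max) v.
  move=> vanti; rewrite {1}bc /int_comb linear_sumlz (bigD1 ord_max)//=.
  rewrite linearZl_LR /= -omb gerDl sumr_le0// => i im.
  by rewrite linearZl_LR /= mulr_ge0_le0 ?ler0z ?c0 ?vanti.
split; last first.
  by rewrite dotC; apply: expand => i im; apply: simple_obtuse.
apply: expand => i im; apply: banti.
by move: (ltn_ord i) im; rewrite ltnS leq_eqVlt -val_eqE /= => /orP[->|].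
Qed.

Lemma antidominant_eq_simple om b :
  (forall i, B om (tnth D i) = (i == ord_max)%:R) ->
  b \in Phi -> 0 < B om b ->
  (forall i : 'I_n.+1, (i < n)%N -> B (tnth D i) b <= 0) ->
  B om b ^+ 2 * B (tnth D ord_max) (tnth D ord_max) <= B b b ->
  b = tnth D ord_max.
Proof.
move=> omD bP b0 banti bnorm.
have [] := antidominant_norm omD bP b0 banti.
set a := tnth D ord_max in bnorm *; set c := B om b in b0 bnorm * => le1 le2.
have bca : b = c *: a.
  apply/subr0_eq/(@dot_eq0 _ _ B)/le_anti/andP; split; last first.
    case: (eqVneq (b - c *: a) 0) => [->|]; first by rewrite linear0l.
    by move/(dot_gt0 B)/ltW.
  rewrite !linearBl !linearBr !linearZl_LR !linearZr_LR /= (dotC B b a).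
  (* |b - ca|^2 = (|b|^2 - c (a|b)) + (c^2 |a|^2 - c (a|b)) *)
  have := ler_wpM2l (ltW b0) le2; rewrite mulrA -expr2 => le3.
  nra.
have [//|ba] := root_line (DP ord_max) bP bca.
by move: b0; rewrite /c ba linearNr /= omD eqxx oppr_gt0 ltr10.
Qed.

(** * Orbits of the standard parabolic subgroup *)

Let P := generated [set refl B (tnth D i) | i in [set i : 'I_n.+1 | (i < n)%N]].

Lemma parabolic_invariants om f :
  (forall i : 'I_n.+1, (i < n)%N -> B om (tnth D i) = 0) -> P f ->
  [/\ forall x, x \in Phi -> f x \in Phi, forall x, B om (f x) = B om x
    & forall x, B (f x) (f x) = B x x].
Proof.
move=> omD Pf; apply: (generated_involutions_ind
  (Q := fun f => [/\ forall x, x \in Phi -> f x \in Phi,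
    forall x, B om (f x) = B om x & forall x, B (f x) (f x) = B x x]) _ _ _ Pf).
- by split=> x; rewrite id_lfunE.
- move=> g h [gP gom gB] [hP hom hB].
  by split=> x; rewrite comp_lfunE ?gom ?gB// => /hP/gP.
- move=> s [i /= ilt <-]; have i0 := root_neq0 (DP i).
  split; first exact: refl_invol.
  split=> x; [exact: refl_root| |exact: refl_isometry].
  by rewrite reflE linearBr linearZr_LR /= omD// mulr0 subr0.
Qed.

(** Where the height $(\rho|\cdot)$ is least on the orbit, reflecting in
    $\alpha_i$ cannot lower it, and it lowers it by the Cartan number
    $2(\alpha_i|b)/(\alpha_i|\alpha_i)$. *)
Lemma parabolic_antidominant b : b \in Phi ->
  exists2 w, P w & forall i : 'I_n.+1, (i < n)%N -> B (tnth D i) (w b) <= 0.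
Proof.
move=> bP; case: (DS) => _ Dbasis _.
have [rho rhoD] := dual_vector B Dbasis (fun=> 1).
pose orb (i : 'I_(size Phi)) := `[< exists2 w, P w & w b = Phi`_i >].
have ib : (index b Phi < size Phi)%N by rewrite index_mem.
have orb0 : orb (Ordinal ib).
  apply/asboolP; exists \1%VF; first exact: generated_id.
  by rewrite id_lfunE /= nth_index.
case: (arg_minP (fun i : 'I_(size Phi) => B rho (Phi`_i)) orb0) => k.
move=> /asboolP [w Pw wk] kmin; exists w => // i ilt.
have wP : w b \in Phi by rewrite wk mem_nth.
have sP : refl B (tnth D i) (w b) \in Phi by rewrite refl_root.
have ib2 : (index (refl B (tnth D i) (w b)) Phi < size Phi)%N.
  by rewrite index_mem.
have /kmin : orb (Ordinal ib2).
  apply/asboolP; exists (refl B (tnth D i) \o w)%VF.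
    by apply: generated_comp => //; apply: generated_mem; exists i.
  by rewrite comp_lfunE /= nth_index.
rewrite /= nth_index// -wk [in leRHS]reflE linearBr linearZr_LR /= rhoD mulr1.
by rewrite lerBDr gerDl pmulr_lle0 ?invr_gt0 ?root_gt0// pmulr_rle0.
Qed.

Lemma parabolic_to_simple om b :
  (forall i, B om (tnth D i) = (i == ord_max)%:R) ->
  b \in Phi -> 0 < B om b ->
  B om b ^+ 2 * B (tnth D ord_max) (tnth D ord_max) <= B b b ->
  exists2 w, P w & w b = tnth D ord_max.
Proof.
move=> omD bP b0 bnorm; have [w Pw wanti] := parabolic_antidominant bP.
have om0 (i : 'I_n.+1) : (i < n)%N -> B om (tnth D i) = 0.
  by move=> ilt; rewrite omD -val_eqE /= ltn_eqF.
have [wP wom wB] := parabolic_invariants om0 Pw.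
exists w => //; apply: (antidominant_eq_simple omD); rewrite ?wom ?wB//.
exact: wP.
Qed.

End Simple.
End Roots.

(** * Conjugating the generating root to a simple root *)

Theorem theorem1p6 (R : realType) (V : vectType R) (B : {dot V for idfun})
    (n : nat) (Phi : seq V) (W T : set 'End(V))
    (alpha : n.+1.-tuple V) (P : set 'End(V)) (beta : V) :
  dual_coxeter_system B n.+1 Phi W T ->
  simple_system Phi alpha ->
  P = generated [set refl B (tnth alpha i) | i in [set i : 'I_n.+1 | (i < n)%N]] ->
  parabolic W T P ->
  beta \in Phi ->
  W = generated (P `|` [set refl B beta]) ->
  exists2 w : 'End(V), P w &
    (w beta = tnth alpha ord_max \/ w beta = - tnth alpha ord_max) /\
    (positive alpha beta -> w beta = tnth alpha ord_max).
Proof.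
move=> [_ PhiR TE WT] DS PE _ bP Wgen.
case: (DS) => DP Dbasis _.
have [om omD] := dual_vector B Dbasis (fun i => (i == ord_max)%:R).
have [||b0 bnorm] := generating_root_norm (W := W) PhiR DP bP omD.
- rewrite Wgen; apply: generated_sub => f [|->]; last first.
    by apply: generated_mem; right.
  rewrite PE; apply: generated_sub => {}f If.
  by apply: generated_mem; left.
- rewrite WT TE; apply: generated_mem; exists (tnth alpha ord_max) => //=.
  exact/DP/mem_tnth.
have [b_lt0|b_gt0|] := ltgtP (B om beta) 0; last by move/eqP: b0.
(* Here beta is a negative root, and it is its opposite that reaches the
   last simple root. *)
- have [||w Pw wb] := parabolic_to_simple PhiR DS omD (oppr_root PhiR bP).
  + by rewrite linearNr oppr_gt0.
  + by rewrite linearNr sqrrN hnormN.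
  exists w; first by rewrite PE.
  move: wb; rewrite linearN => /(canRL opprK) wb; split; first by right.
  move=> [c bc c0]; move: b_lt0.
  by rewrite bc (dual_int_comb _ omD) ltrz0 ltNge c0.
- have [w Pw wb] := parabolic_to_simple PhiR DS omD bP b_gt0 bnorm.
  by exists w; [rewrite PE|split; [left|]].
Qed.
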